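(* Every lattice barycentric tetrahedron $T \subset \mathbb{R}^3$ is unimodularly equivalent to either $T(3,3,4)$ or $T(7,11,20)$.
   Context: For affinely independent points $v_1,v_2,v_3,v_4\in\mathbb{R}^3$, the tetrahedron with these vertices is $T(v_1,v_2,v_3,v_4)=\{\sum_{i=1}^4\lambda_i v_i : 0\le\lambda_i\le 1,\ \sum_{i=1}^4\lambda_i=1\}$. Its interior $\mathrm{int}(T)$ is the set of those points with $0<\lambda_i<1$ for all $1\le i\le 4$, and its boundary is $\partial T = T\setminus \mathrm{int}(T)$. Its barycentre is $BC[T]=\frac14 v_1+\frac14 v_2+\frac14 v_3+\frac14 v_4$. A lattice tetrahedron is a tetrahedron with $v_1,v_2,v_3,v_4\in\mathbb{Z}^3$. A lattice tetrahedron $T$ is fundamental if $\partial T\cap\mathbb{Z}^3=\{v_1,v_2,v_3,v_4\}$. A lattice tetrahedron $T$ is lattice barycentric if it is fundamental and $\mathrm{int}(T)\cap\mathbb{Z}^3=\{BC[T]\}$ (in particular, the barycentre is a lattice point). For integers $a,b,c$, $T(a,b,c)$ denotes the tetrahedron with vertices $0,\ e_1,\ e_2,\ ae_1+be_2+ce_3$, where $e_1,e_2,e_3$ is the standard basis of $\mathbb{R}^3$. $GL(3,\mathbb{Z})$ is the group of $3\times3$ integer matrices with determinant $\pm1$. Two tetrahedra $T_1,T_2$ are unimodularly equivalent if there exist $A\in GL(3,\mathbb{Z})$ and $\vec b\in\mathbb{Z}^3$ such that the map $\vec v\mapsto A\vec v+\vec b$ carries $T_1$ bijectively onto $T_2$.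 *)

(* Defs.v *)
From HB Require Import structures.
From mathcomp Require Import all_boot all_order all_algebra.
From mathcomp Require Import classical_sets functions reals.

Set Implicit Arguments.
Unset Strict Implicit.
Unset Printing Implicit Defensive.

Import Order.TTheory GRing.Theory Num.Theory.
Local Open Scope classical_set_scope.
Local Open Scope ring_scope.

Section Tetrahedra.
Variable R : realType.
Local Notation point := 'cV[R]_3.

Definition integer_points : set point :=
  [set x | forall i, x i 0 \is a Num.int].

Definition affinely_independent (v : 'I_4 -> point) : Prop :=
  forall l : 'I_4 -> R,
    \sum_i l i = 0 -> \sum_i l i *: v i = 0 -> forall i, l i = 0.

Definition tetrahedron (v : 'I_4 -> point) : set point :=
  [set x | exists l : 'I_4 -> R,
    [/\ forall i, 0 <= l i <= 1, \sum_i l i = 1 & x = \sum_i l i *: v i]].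

Definition tetra_interior (v : 'I_4 -> point) : set point :=
  [set x | exists l : 'I_4 -> R,
    [/\ forall i, 0 < l i < 1, \sum_i l i = 1 & x = \sum_i l i *: v i]].

Definition tetra_boundary (v : 'I_4 -> point) : set point :=
  tetrahedron v `\` tetra_interior v.

Definition barycentre (v : 'I_4 -> point) : point :=
  \sum_i (1 / 4) *: v i.

Definition lattice_tetrahedron (v : 'I_4 -> point) : Prop :=
  affinely_independent v /\ forall i, integer_points (v i).

Definition fundamental (v : 'I_4 -> point) : Prop :=
  lattice_tetrahedron v /\ tetra_boundary v `&` integer_points = range v.

Definition lattice_barycentric (v : 'I_4 -> point) : Prop :=
  fundamental v /\
  tetra_interior v `&` integer_points = [set barycentre v].

Definition std_basis (i : 'I_3) : point := delta_mx i 0.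

Definition Tabc_vertices (a b c : int) : 'I_4 -> point :=
  tnth [tuple 0; std_basis 0; std_basis 1;
        a%:~R *: std_basis 0 + b%:~R *: std_basis 1 + c%:~R *: std_basis 2].

Definition Tabc (a b c : int) : set point := tetrahedron (Tabc_vertices a b c).

Definition affine_map (A : 'M[int]_3) (b : 'cV[int]_3) (x : point) : point :=
  map_mx intr A *m x + map_mx intr b.

Definition unimodularly_equivalent (T1 T2 : set point) : Prop :=
  exists (A : 'M[int]_3) (b : 'cV[int]_3),
    (\det A = 1 \/ \det A = -1) /\ set_bij T1 T2 (affine_map A b).

End Tetrahedra.

(* Main.v *)
Require Import Defs.
From mathcomp Require Import all_boot all_order all_algebra.
From mathcomp Require Import perm.
From mathcomp Require Import boolp classical_sets functions reals.
From mathcomp Require Import ring zify.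

(** An empty lattice triangle is part of a basis of the lattice, so in suitable
coordinates a lattice barycentric tetrahedron is T(a, b, c) with c > 0
([normal_form]).  Its barycentre is a lattice point exactly when c is a
multiple 4m of 4 and a = b = 3 mod 4.

Put n = 4m and let x, y, z be the residues of 1 - a - b, a, b modulo n; they
are 3 mod 4, and their sum is 1 mod n.  For 0 < t < n the lattice points in the
class of - t e_3, modulo the lattice spanned by the edges, have barycentric
coordinates congruent modulo 1 to tx/n, ty/n, tz/n, - t/n.  If the fractional
parts of these numbers add up to 1, they are the coordinates of a lattice point
of T that is not a vertex, hence of the barycentre, and t = 3m.  Replacing t by
n - t exchanges the sums 1 and 3, so the sum is 2 unless t is m or 3m, and all
geometry is contained in the condition [lone_residue_sum] on m, x, y, z.

For m > 1 the condition gives, in terms of integer parts, x + y + z = n + 1 and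
[tx/n] + [ty/n] + [tz/n] = t - 1 for every t other than m and 3m
([quotient_sumE]).  Let x be the largest of the three numbers.  Then x > n/2,
and w = n - x = y + z - 1 satisfies [tw/n] = [ty/n] + [tz/n]
([quotient_merge]): the multiples of w pass a multiple of n exactly when those
of y or of z do.  If z >= 7, this already breaks down shortly after the
multiples of z first reach n, while t is still below m ([no_quotient_merge]).
If z = 3, the values of t next to m leave only m <= 10
([quotient_merge3_bound]).  An enumeration of these cases yields m = 1, or
m = 5 with {x, y, z} = {3, 7, 11}.

Finally, shears change a and b by multiples of c, and exchanging vertices
permutes x, y, z; so T is equivalent to T(3, 3, 4) or to T(7, 11, 20). *)

Set Implicit Arguments.
Unset Strict Implicit.
Unset Printing Implicit Defensive.

Import Order.TTheory GRing.Theory Num.Theory.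

(** * Residues and quotients of multiples modulo 4m *)

Definition residue (n t x : nat) : nat := (t * x) %% n.
Definition quotient (n t x : nat) : nat := (t * x) %/ n.

(** With n = 4m, the residues of tx, ty, tz and n - t are n times the
barycentric coordinates of a lattice point of T(a, b, n) when they add up to n,
that is, when the first three add up to t.  The condition says that this point
can only be the barycentre. *)
Definition lone_residue_sum (m x y z : nat) : Prop :=
  forall t, 0 < t < 4 * m ->
    residue (4 * m) t x + residue (4 * m) t y + residue (4 * m) t z = t ->
    [/\ t = 3 * m, residue (4 * m) t x = m, residue (4 * m) t y = m
      & residue (4 * m) t z = m].

Lemma ltn_residue n t x : 0 < n -> residue n t x < n.
Proof. exact: ltn_pmod. Qed.

Lemma quotient_residue n t x : t * x = quotient n t x * n + residue n t x.
Proof. exact: divn_eq. Qed.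

Lemma leq_quotient n t x k : 0 < n -> (k <= quotient n t x) = (k * n <= t * x).
Proof. by move=> n0; rewrite leq_divRL. Qed.

Lemma residueB n t x : t <= n -> 0 < residue n t x ->
  residue n (n - t) x = n - residue n t x.
Proof.
move=> tn; have [-> |n0] := posnP n; first by rewrite /residue sub0n mul0n mod0n.
have : residue n (n - t) x + residue n t x = 0 %[mod n].
  by rewrite modnDm -mulnDl subnK // modnMr mod0n.
have := ltn_residue t x n0; have := ltn_residue (n - t) x n0.
move: (residue n _ x) (residue n t x) => a b an bn /[swap] b0.
case: (ltnP (a + b) n) => ab; first by rewrite mod0n modn_small; lia.
rewrite (_ : a + b = (a + b - n) + n); last by lia.
by rewrite modnDr mod0n modn_small; lia.
Qed.

Lemma residueB0 n t x : t <= n -> residue n t x = 0 -> residue n (n - t) x = 0.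
Proof.
move=> tn r0; apply/eqP; rewrite /residue mulnBl; apply: dvdn_sub.
  exact: dvdn_mulr.
by apply/eqP.
Qed.

(** The sum is congruent to t, and it is less than 3n. *)
Lemma residue_sum_mod n x y z t : (x + y + z) %% n = 1 -> t < n ->
  exists2 k, k <= 2 & residue n t x + residue n t y + residue n t z = t + k * n.
Proof.
move=> s tn; have n0 : 0 < n by lia.
have := ltn_residue t x n0; have := ltn_residue t y n0.
have := ltn_residue t z n0.
have : (residue n t x + residue n t y + residue n t z) %% n = t.
  rewrite modnDmr -addnA modnDml addnCA modnDml addnCA addnA.
  by rewrite -!mulnDr -modnMmr s muln1 modn_small.
move: (residue n t x) (residue n t y) (residue n t z) => a b c e hc hb ha.
have := divn_eq (a + b + c) n; rewrite e => d.
exists ((a + b + c) %/ n); last by rewrite {1}d addnC.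
by rewrite -ltnS ltn_divLR //; clear -ha hb hc; lia.
Qed.

Lemma lone_residue_sumC m x y z : lone_residue_sum m x y z -> lone_residue_sum m y x z.
Proof. by move=> L t tb; rewrite (addnC (residue _ t y)) => /(L t tb)[]. Qed.

Lemma lone_residue_sumAC m x y z : lone_residue_sum m x y z -> lone_residue_sum m x z y.
Proof. by move=> L t tb; rewrite addnAC => /(L t tb)[]. Qed.

(** If the residue of tx vanishes, the three residues add up to t or to t + n.
In the second case the residues for n - t add up to n - t, and the residue of
(n - t)x vanishes as well.  So in both cases the hypothesis applies to a
vanishing residue, which it says to be m. *)
Lemma residue_gt0 m x y z t : lone_residue_sum m x y z ->
  (x + y + z) %% (4 * m) = 1 -> 0 < t < 4 * m -> 0 < residue (4 * m) t x.
Proof.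
move=> L s tb; have n0 : 0 < 4 * m by lia.
rewrite lt0n; apply/negP => /eqP r0.
have tn : t < 4 * m by lia.
have [k k2 e] := residue_sum_mod s tn.
have := L t tb.
have := L (4 * m - t) ltac:(lia).
rewrite (residueB0 (ltnW tn) r0).
have := @residueB (4 * m) t y (ltnW tn).
have := @residueB (4 * m) t z (ltnW tn).
have := ltn_residue t y n0; have := ltn_residue t z n0.
move: (residue _ (_ - t) _) (residue _ (_ - t) _) e; rewrite r0.
move: (residue _ _ _) (residue _ _ _) => b c b' c' e cn bn hc hb hL hL'.
have := tb => /andP[t0 _].
case: k k2 e => [|[|[|//]]] _ e.
- by have [] := hL' ltac:(lia); lia.
- by have [] := hL ltac:(lia); lia.
- by lia.
Qed.

Lemma residue_gt0_all m x y z t : lone_residue_sum m x y z ->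
  (x + y + z) %% (4 * m) = 1 -> 0 < t < 4 * m ->
  [/\ 0 < residue (4 * m) t x, 0 < residue (4 * m) t y & 0 < residue (4 * m) t z].
Proof.
move=> L s tb; split; first exact: (residue_gt0 L).
- by apply: (residue_gt0 (lone_residue_sumC L)) => //; rewrite (addnC y).
- apply: (residue_gt0 (lone_residue_sumC (lone_residue_sumAC L))) => //.
  by rewrite (_ : z + x + y = x + y + z) //; lia.
Qed.

(** Since no residue vanishes, passing from t to n - t replaces the sum of the
residues by its complement to 3n.  Hence the sums t and t + 2n are both governed
by the hypothesis, which reserves them for t = 3m and for t = m. *)
Lemma residue_sumE m x y z t : lone_residue_sum m x y z ->
  (x + y + z) %% (4 * m) = 1 -> 0 < t < 4 * m -> t <> m -> t <> 3 * m ->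
  residue (4 * m) t x + residue (4 * m) t y + residue (4 * m) t z = t + 4 * m.
Proof.
move=> L s tb tm t3m.
have tn : t < 4 * m by lia.
have [k k2 e] := residue_sum_mod s tn.
have [hx hy hz] := residue_gt0_all L s tb.
have := L t tb.
have := L (4 * m - t) ltac:(lia).
rewrite !residueB ?(ltnW tn) // {L s}.
have n0 : 0 < 4 * m by lia.
have := ltn_residue t x n0; have := ltn_residue t y n0; have := ltn_residue t z n0.
move: (residue _ _ _) (residue _ _ _) (residue _ _ _) hx hy hz e.
move=> a b c ha hb hc e cn bn an L1 L2.
case: k k2 e => [|[|[|//]]] _ e.
- by have [] := L2 ltac:(lia).
- by lia.
- by have [] := L1 ltac:(lia); lia.
Qed.

Lemma quotient_sumE m x y z t : lone_residue_sum m x y z ->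
  x + y + z = 4 * m + 1 -> 0 < t < 4 * m -> t <> m -> t <> 3 * m ->
  (quotient (4 * m) t x + quotient (4 * m) t y + quotient (4 * m) t z).+1 = t.
Proof.
move=> L s tb tm t3m.
have s1 : (x + y + z) %% (4 * m) = 1 by rewrite s modnDl modn_small; lia.
have := residue_sumE L s1 tb tm t3m.
have := congr1 (muln t) s; rewrite !mulnDr muln1.
rewrite (quotient_residue (4 * m) t x) (quotient_residue (4 * m) t y).
rewrite (quotient_residue (4 * m) t z).
move: (quotient _ _ _) (quotient _ _ _) (quotient _ _ _) => qx qy qz.
move: (residue _ _ _) (residue _ _ _) (residue _ _ _) => rx ry rz e2 e1 {L s s1}.
have : (qx + qy + qz).+1 * (4 * m) = t * (4 * m) by rewrite mulSn !mulnDl; lia.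
by move/eqP; rewrite eqn_mul2r => /orP[/eqP|/eqP //]; lia.
Qed.

(** Here y + z - 1 = n - x, and [t(n - x)/n] = t - 1 - [tx/n] because n does
not divide tx. *)
Lemma quotient_merge m x y z t : lone_residue_sum m x y z ->
  x + y + z = 4 * m + 1 -> x <= 4 * m -> 0 < t < 4 * m -> t <> m -> t <> 3 * m ->
  quotient (4 * m) t (y + z - 1) = quotient (4 * m) t y + quotient (4 * m) t z.
Proof.
move=> L s xn tb tm t3m.
have s1 : (x + y + z) %% (4 * m) = 1 by rewrite s modnDl modn_small; lia.
have n0 : 0 < 4 * m by lia.
have := quotient_sumE L s tb tm t3m.
have := residue_gt0 L s1 tb.
have := ltn_residue t x n0; have := quotient_residue (4 * m) t x.
have : t * (y + z - 1) + t * x = t * (4 * m).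
  by rewrite -mulnDr; congr muln; clear -s xn; lia.
rewrite [quotient _ t (_ - 1)]/quotient; move: (t * x) (t * _) => B A {L s xn s1}.
move: (residue _ _ _) (quotient _ t x) (quotient _ t y) (quotient _ t z).
move=> r q b c e1 e2 r1 r2 e3.
have e4 : A = (b + c) * (4 * m) + (4 * m - r).
  have : A + (q * (4 * m) + r) = (q + b + c).+1 * (4 * m) by rewrite -e2 e1 e3.
  by rewrite mulSn !mulnDl; clear -r1; lia.
by rewrite e4 divnMDl // (divn_small (m := 4 * m - r)) ?addn0 //; clear -r2 n0; lia.
Qed.

(** Put w = y + z - 1.  As t grows, [tw/n] counts the multiples of n passed by
the multiples of w, and by hypothesis every passage of w is a passage of y or
one of z, not both.  Let t be the time of the first passage of z, and k the
number of passages of y by then.  Since 2w < n, two passages of w are more than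
one step apart, so y makes no passage at t or t + 1.  Let p be the time of the
k-th passage of y.  In the t + 1 - p steps from p - 1 to t, w goes from below kn
to at least (k+1)n; in the same number of steps from p to t + 1, y stays between
kn and (k+1)n.  Started at 0, that many steps make w pass n, whereas y and z do
not. *)
Lemma no_quotient_merge (n y z T : nat) : 0 < z -> z <= y -> 2 * (y + z - 1) < n ->
  n <= (T - 2) * z ->
  (forall t, 0 < t < T -> quotient n t (y + z - 1) = quotient n t y + quotient n t z) ->
  False.
Proof.
move=> z0 zy wn Tz G; set w := y + z - 1 in wn G.
have n0 : 0 < n by lia.
have T0 : 2 < T by case: leqP => // T2; move: Tz; rewrite (_ : T - 2 = 0); lia.
have ex : exists t, n <= t * z by exists (T - 2).
(* the first passage of z *)
have [t tz tmin] := ex_minnP ex.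
have tT : t <= T - 2 by exact: tmin.
have t1 : 1 < t.
  by rewrite ltnNge; apply/negP => t1; move: tz; rewrite leqNgt => /negP[]; nia.
have tz' : (t - 1) * z < n.
  by rewrite ltnNge; apply/negP => /tmin; lia.
have qz_before : quotient n (t - 1) z = 0 by rewrite /quotient divn_small.
have mono u a b : a <= b -> quotient n a u <= quotient n b u.
  by move=> ab; apply: leq_div2r; rewrite leq_mul2r ab orbT.
have qz_at : 0 < quotient n t z by rewrite divn_gt0.
have qz_after : 0 < quotient n t.+1 z by apply: leq_trans (mono z _ _ (leqnSn t)).
(* w makes at most one passage in two steps, as 2w < n *)
have step2 : quotient n t.+1 w <= (quotient n (t - 1) w).+1.
  rewrite -[X in _ <= X]add1n /quotient -divnMDl //; apply: leq_div2r.
  by rewrite (_ : t.+1 = t - 1 + 2) ?mulnDl; clear -t1 wn; lia.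
have G0 : quotient n (t - 1) w = quotient n (t - 1) y.
  by rewrite G ?qz_before ?addn0 //; lia.
have G2 := G t.+1 ltac:(clear -tT T0; lia).
have G1 := G t ltac:(clear -t1 tT T0; lia).
have m1 := mono y (t - 1) t ltac:(clear; lia).
have m2 := mono y t t.+1 ltac:(clear; lia).
pose k := quotient n t y.
have k0 : 0 < k by rewrite /k divn_gt0 // (leq_trans tz) // leq_mul2l zy orbT.
have exp : exists p, k * n <= p * y by exists t; rewrite -leq_quotient.
(* the k-th passage of y *)
have [p py pmin] := ex_minnP exp.
have kt : k <= quotient n (t - 1) y.
  by rewrite /k; clear -G0 G1 G2 m1 m2 step2 qz_at qz_after; lia.
have pt : p <= t - 1 by apply: pmin; rewrite -leq_quotient.
have p1 : 1 < p.
  rewrite ltnNge; apply/negP => p1; move: py; rewrite leqNgt => /negP[].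
  by clear -p1 k0 wn zy z0; nia.
have py' : (p - 1) * y < k * n by rewrite ltnNge; apply/negP => /pmin; clear -p1; lia.
have pw : (p - 1) * w < k * n.
  have := G (p - 1) ltac:(clear -p1 pt tT; lia).
  have := mono z (p - 1) (t - 1) ltac:(clear -pt; lia); rewrite qz_before leqn0 => /eqP ->.
  by rewrite addn0 => e; move: py'; rewrite !ltnNge -!leq_quotient // e.
have tw : k.+1 * n <= t * w.
  by rewrite -leq_quotient // /k; clear -G1 qz_at; lia.
have ty : t.+1 * y < k.+1 * n.
  rewrite ltnNge -leq_quotient // -ltnNge ltnS.
  by clear -G0 G1 G2 m1 m2 step2 qz_at qz_after kt; lia.
(* the number of steps on which w and y disagree *)
pose s := t.+1 - p.
have sw : n <= s * w.
  have e : s = t - (p - 1) by rewrite /s; clear -p1; lia.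
  by rewrite e mulnBl; move: tw; rewrite mulSn; clear -pw; lia.
have sy : s * y < n by rewrite /s mulnBl; move: ty; rewrite mulSn; clear -py; lia.
have sb : 0 < s < T by rewrite /s; clear -p1 pt tT t1; lia.
have sz : s * z < n.
  by apply: leq_ltn_trans tz'; rewrite leq_mul2r /s; clear -p1; lia.
have := G s sb.
rewrite {2 3}/quotient (divn_small sy) (divn_small sz).
by move: sw; rewrite -divn_gt0 // /quotient; case: (_ %/ _).
Qed.

(** The case y = 4q - 1, z = 3, w = 4q + 1 of the merging of quotients.  The
multiples of 3 do not reach n = 4m for t <= m + 1, so for these t other than m
no multiple of n lies in the interval ]ty, tw].  At t = m + 1 the number qn is
at most tw, hence also at most ty, so that m <= y and even m < y.  For t = m - 2
and t = m - 3 the interval contains (q-1)n unless 8q <= 3m + 2 and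
5m <= 12q + 2, respectively; the two inequalities bound q by 4 and m by 10. *)
Lemma quotient_merge3_bound m q : 5 <= m -> 4 * q + 1 < 2 * m -> 0 < q ->
  4 * q - 1 <> m ->
  (forall t, 0 < t < 4 * m -> t <> m -> t <> 3 * m ->
   quotient (4 * m) t (4 * q + 1) =
     quotient (4 * m) t (4 * q - 1) + quotient (4 * m) t 3) ->
  m <= 10.
Proof.
move=> m5 qm q0 neq G; have n0 : 0 < 4 * m by lia.
have small t : t * 3 < 4 * m -> quotient (4 * m) t 3 = 0 by exact: divn_small.
have up : m <= 4 * q - 1.
  have := G m.+1 ltac:(lia) ltac:(lia) ltac:(lia).
  rewrite (small m.+1) ?addn0; last by clear -m5; lia.
  case: (leqP m (4 * q - 1)) => // mq e.
  have : q <= quotient (4 * m) m.+1 (4 * q + 1) by rewrite leq_quotient //; clear; nia.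
  by rewrite e leq_quotient //; clear -mq q0; nia.
have no_jump t k : 0 < t -> t < m -> t * 3 < 4 * m ->
   k * (4 * m) <= t * (4 * q + 1) -> k * (4 * m) <= t * (4 * q - 1).
  move=> t0 tm t3; rewrite -!leq_quotient // G ?(small t t3) ?addn0 //; clear -t0 tm; lia.
have j1 := no_jump (m - 2) (q - 1) ltac:(lia) ltac:(lia) ltac:(lia).
have j2 := no_jump (m - 3) (q - 1) ltac:(lia) ltac:(lia) ltac:(lia).
have h1 : 8 * q <= 3 * m + 2.
  rewrite leqNgt; apply/negP => h.
  by move: j1 => /(_ ltac:(clear -h q0 qm; nia)); clear -h qm q0; nia.
have h2 : 5 * m <= 12 * q + 2.
  rewrite leqNgt; apply/negP => h.
  by move: j2 => /(_ ltac:(clear -h q0 qm m5; nia)); clear -h q0 qm up neq; nia.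
by clear -h1 h2; lia.
Qed.

(** For t = 2 the three quotients add up to 1, so the largest number x exceeds
2m; this makes w = y + z - 1 less than 2m, as the two cases z = 3 and z >= 7
require. *)
Lemma lone_residue_sum_bound_sorted m x y z :
  lone_residue_sum m x y z -> x + y + z = 4 * m + 1 ->
  x < 4 * m -> x %% 4 = 3 -> y %% 4 = 3 -> z %% 4 = 3 -> z <= y -> y <= x -> m <= 10.
Proof.
move=> L s xn x4 y4 z4 zy yx; rewrite leqNgt; apply/negP => m10.
(* x = 2m is impossible because x is odd *)
have xbig : 2 * m < x.
  have := quotient_sumE (t := 2) L s ltac:(lia) ltac:(lia) ltac:(lia).
  case: (ltnP (2 * m) x) => // xm.
  have small u : u <= x -> quotient (4 * m) 2 u = 0.
    by move=> ux; apply: divn_small; clear -ux xm x4; lia.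
  by rewrite !small //; clear -yx zy; lia.
have merge := quotient_merge L s (ltnW xn).
have [z3|z7] : z = 3 \/ 7 <= z by clear -z4; lia.
(* y = m would give 4y = 4m, and the residue for t = 4 would vanish *)
- have ym : y <> m.
    move=> ym; have s1 : (y + x + z) %% (4 * m) = 1.
      by rewrite (addnC y) s modnDl modn_small //; clear -m10; lia.
    have := residue_gt0 (t := 4) (lone_residue_sumC L) s1 ltac:(clear -m10; lia).
    by rewrite /residue ym modnn.
  have [q yq] : exists q, y = 4 * q - 1 by exists (y.+1 %/ 4); clear -y4; lia.
  have wE : 4 * q + 1 = y + z - 1 by clear -yq z3 y4; lia.
  have : m <= 10; last by rewrite leqNgt m10.
  apply: (@quotient_merge3_bound m q) => [||||t tb tm t3m].
  + by clear -m10; lia.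
  + by clear -wE s xbig y4; lia.
  + by clear -yq y4; lia.
  + by rewrite -yq.
  + by have := merge t tb tm t3m; rewrite -wE z3 yq.
- apply: (@no_quotient_merge (4 * m) y z m) => [||||t tb] //.
  + by clear -z7; lia.
  + by clear -s xbig z7; lia.
  + by clear -z7 m10; nia.
  + by rewrite merge //; clear -tb; lia.
Qed.

Lemma lone_residue_sum_bound m x y z :
  lone_residue_sum m x y z -> x + y + z = 4 * m + 1 ->
  x < 4 * m -> y < 4 * m -> z < 4 * m ->
  x %% 4 = 3 -> y %% 4 = 3 -> z %% 4 = 3 -> m <= 10.
Proof.
wlog yx : x y z / y <= x => [hw L s xn yn zn x4 y4 z4|].
  case: (leqP y x) => [|/ltnW] xy; first exact: (hw x y z).
  by apply: (hw y x z) => //; [exact: lone_residue_sumC | rewrite (addnC y)].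
wlog zx : x y z yx / z <= x => [hw L s xn yn zn x4 y4 z4|].
  case: (leqP z x) => [|/ltnW] xz; first exact: (hw x y z).
  apply: (hw z y x) => //; first exact: leq_trans xz.
    exact/lone_residue_sumC/lone_residue_sumAC/lone_residue_sumC.
  by rewrite -s; clear; lia.
move=> L s xn yn zn x4 y4 z4.
case: (leqP z y) => [|/ltnW] zy; first exact: (lone_residue_sum_bound_sorted L).
by apply: (lone_residue_sum_bound_sorted (lone_residue_sumAC L)) => //; rewrite addnAC.
Qed.

(** The numbers x and y are 4i + 3 and 4j + 3, and z is the residue that makes
the sum congruent to 1; the multiple 20m of 4m keeps the subtraction exact. *)
Definition small_check (m i j : nat) : bool :=
  let y := [:: 4 * i + 3; 4 * j + 3; (20 * m - (4 * i + 4 * j + 5)) %% (4 * m)] in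
  all (fun t => (sumn [seq residue (4 * m) t x | x <- y] == t) ==> (t == 3 * m))
         (iota 1 (4 * m).-1)
  ==> (m == 1) || (m == 5) && perm_eq y [:: 3; 7; 11].

Lemma small_checkT :
  all (fun m => all (fun i => all (small_check m i) (iota 0 m)) (iota 0 m)) (iota 1 10).
Proof. by vm_compute. Qed.

Lemma lone_residue_sum_classification m x y z : 0 < m -> lone_residue_sum m x y z ->
  x < 4 * m -> y < 4 * m -> z < 4 * m ->
  x %% 4 = 3 -> y %% 4 = 3 -> z %% 4 = 3 -> (x + y + z) %% (4 * m) = 1 ->
  m = 1 \/ m = 5 /\ perm_eq [:: x; y; z] [:: 3; 7; 11].
Proof.
move=> m0 L xn yn zn x4 y4 z4 s.
have [->|m1] := eqVneq m 1; first by left.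
have s1 : x + y + z = 4 * m + 1.
  have := residue_sumE (t := 1) L s ltac:(lia) ltac:(lia) ltac:(lia).
  by rewrite /residue !mul1n !modn_small // => ->; rewrite addnC.
have m10 := lone_residue_sum_bound L s1 xn yn zn x4 y4 z4.
have [i xi] : exists i, x = 4 * i + 3 by exists (x %/ 4); clear -x4; lia.
have [j yj] : exists j, y = 4 * j + 3 by exists (y %/ 4); clear -y4; lia.
have zE : z = (20 * m - (4 * i + 4 * j + 5)) %% (4 * m).
  rewrite (_ : 20 * m - _ = 4 * (4 * m) + z) ?modnMDl ?modn_small //.
  by clear -s1 xi yj xn yn; lia.
have := allP small_checkT m ltac:(rewrite mem_iota; clear -m0 m10; lia).
move=> /allP/(_ i ltac:(rewrite mem_iota; clear -xi xn; lia)).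
move=> /allP/(_ j ltac:(rewrite mem_iota; clear -yj yn; lia)).
rewrite /small_check -zE -xi -yj; case: allP => [_ /orP[/eqP|/andP[/eqP m5 e]]|[t]].
- by left.
- by right.
rewrite mem_iota => tb; apply/implyP => /eqP.
rewrite /= addn0 addnA => e; apply/eqP.
by have [] := L t ltac:(clear -tb; lia) e.
Qed.

Section Geometry.
Local Open Scope classical_set_scope.
Local Open Scope ring_scope.
Variable R : realType.

(** * Unimodular equivalences from maps of vertices *)

Definition real_points (v : 'I_4 -> 'cV[int]_3) (i : 'I_4) : 'cV[R]_3 :=
  map_mx intr (v i).

Lemma tetrahedron_ext (v w : 'I_4 -> 'cV[R]_3) : v =1 w -> tetrahedron v = tetrahedron w.
Proof. by move=> /funext ->. Qed.

Lemma affine_map_sum A b (v : 'I_4 -> 'cV[R]_3) (l : 'I_4 -> R) : \sum_i l i = 1 ->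
  affine_map A b (\sum_i l i *: v i) = \sum_i l i *: affine_map A b (v i).
Proof.
move=> l1; rewrite /affine_map mulmx_sumr.
under [RHS]eq_bigr do rewrite scalerDr.
rewrite big_split /= -scaler_suml l1 scale1r; congr (_ + _).
by apply: eq_bigr => i _; rewrite scalemxAr.
Qed.

Lemma affine_map_inj (A : 'M[int]_3) b : A \in unitmx -> injective (@affine_map R A b).
Proof.
move=> uA x y /(addIr _) /(congr1 (mulmx (map_mx intr (invmx A)))).
by rewrite !mulmxA -map_mxM mulVmx // map_mx1 !mul1mx.
Qed.

Lemma tetrahedron_perm (v : 'I_4 -> 'cV[R]_3) (s : 'I_4 -> 'I_4) :
  injective s -> tetrahedron (v \o s) `<=` tetrahedron v.
Proof.
move=> s_inj x [l [l01 l1 ->]].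
have [t ts st] := injF_bij s_inj.
exists (l \o t); split => [i||]; first exact: l01.
- rewrite -l1 (reindex s) /=; first by apply: eq_bigr => i _; rewrite ts.
  by apply: onW_bij; exists t.
- rewrite [RHS](reindex s) /=; first by apply: eq_bigr => i _; rewrite ts.
  by apply: onW_bij; exists t.
Qed.

Lemma unimodular_tetrahedra (v w : 'I_4 -> 'cV[int]_3) A b (s : 'I_4 -> 'I_4) :
  A \in unitmx -> injective s -> (forall i, A *m v i + b = w (s i)) ->
  unimodularly_equivalent (tetrahedron (real_points v)) (tetrahedron (real_points w)).
Proof.
move=> uA s_inj vw; exists A, b; split.
  by move: uA; rewrite unitmxE => /orP[] /eqP; [left | right].
have vwR : affine_map A b \o real_points v = real_points w \o s.
  by apply: funext => i; rewrite /= /affine_map /real_points -vw map_mxD map_mxM.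
have imv l : \sum_i l i = 1 ->
    affine_map A b (\sum_i l i *: real_points v i) = \sum_i l i *: real_points w (s i).
  move=> l1; rewrite affine_map_sum //; apply: eq_bigr => i _; congr (_ *: _).
  exact: (congr1 (fun f => f i) vwR).
split => [x [l [l01 l1 ->]]|x y _ _|x [l [l01 l1 ->]]].
- by apply: (tetrahedron_perm s_inj); exists l; split => //; exact: imv.
- exact: affine_map_inj.
- exists (\sum_i l (s i) *: real_points v i); last first.
    rewrite imv -?l1; last by rewrite [RHS](reindex_inj s_inj).
    by rewrite [RHS](reindex_inj s_inj).
  exists (l \o s); split => // [i|]; first exact: l01.
  by rewrite -l1 [RHS](reindex_inj s_inj).
Qed.

Lemma unimodularly_equivalent_trans (T1 T2 T3 : set 'cV[R]_3) :
  unimodularly_equivalent T1 T2 -> unimodularly_equivalent T2 T3 ->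
  unimodularly_equivalent T1 T3.
Proof.
move=> [A [a [detA [fA iA sA]]]] [B [b [detB [fB iB sB]]]].
exists (B *m A), (B *m a + b); split.
  by rewrite det_mulmx; case: detA detB => -> [] ->;
    rewrite ?mulr1 ?mul1r ?opprK; [left|right|right|left].
have -> : affine_map (B *m A) (B *m a + b) = affine_map B b \o @affine_map R A a.
  by apply: funext => x; rewrite /affine_map /= map_mxD !map_mxM mulmxDr mulmxA addrA.
split=> [x /fA /fB //|x y|x /sB [y /sA [z Tz <-] <-]]; last by exists z.
rewrite !inE => Tx Ty /= e; apply: iA; rewrite ?inE //.
by apply: iB => //; rewrite inE; exact: fA.
Qed.

(** * The lattice barycentric condition in integers *)

(** The notion [lattice_barycentric] with denominators cleared: nonnegative
integers r i with sum n describe the point with barycentric coordinates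
r i / n, and it is a lattice point if the corresponding combination of vertices
is n times an integer vector.  Then it is a vertex, where some r i is n, or the
barycentre, where every r i is n / 4. *)
Definition lattice_barycentricZ (v : 'I_4 -> 'cV[int]_3) : Prop :=
 [/\ forall r : 'I_4 -> int, \sum_i r i = 0 -> \sum_i r i *: v i = 0 ->
       forall i, r i = 0,
     forall (n : int) (r : 'I_4 -> int) g, 0 < n -> (forall i, 0 <= r i) ->
       \sum_i r i = n -> \sum_i r i *: v i = n *: g ->
       (exists j, r j = n) \/ (forall i, r i * 4 = n)
   & exists g, \sum_i v i = 4 *: g].

Lemma integer_pointsP (x : 'cV[R]_3) :
  integer_points x -> exists g : 'cV[int]_3, x = map_mx intr g.
Proof.
move=> xZ; exists (\col_i Num.floor (x i 0)); apply/matrixP => i j.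
by rewrite !mxE ord1 floorK.
Qed.

Lemma affinely_independent_inj (v : 'I_4 -> 'cV[R]_3) l l' :
  affinely_independent v -> \sum_i l i = \sum_i l' i ->
  \sum_i l i *: v i = \sum_i l' i *: v i -> l =1 l'.
Proof.
move=> ind s e i; apply/eqP; rewrite -subr_eq0; apply/eqP.
apply: (ind (fun i => l i - l' i)) => [|]; first by rewrite sumrB s subrr.
by under eq_bigr do rewrite scalerBl; rewrite sumrB e subrr.
Qed.

(** Affine independence turns equalities between points, with the barycentre
or with a vertex, into equalities between barycentric coordinates. *)
Lemma lattice_barycentricP (v : 'I_4 -> 'cV[R]_3) : lattice_barycentric v ->
  exists2 vz, v =1 real_points vz & lattice_barycentricZ vz.
Proof.
move=> [[[ind vZ] bd] itr].
have /choice [vz vE] : forall i, exists g : 'cV[int]_3, v i = map_mx intr g.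
  by move=> i; exact/integer_pointsP/vZ.
have sumZ (r : 'I_4 -> int) : \sum_i (r i)%:~R *: v i = map_mx intr (\sum_i r i *: vz i).
  by rewrite raddf_sum /=; apply: eq_bigr => i _; rewrite map_mxZ vE.
exists vz => //; split.
- move=> r r0 rv0 i; apply/eqP; rewrite -(intr_eq0 R); apply/eqP.
  apply: (ind (fun i => (r i)%:~R)); last by rewrite sumZ rv0 map_mx0.
  by rewrite -[RHS](@mulr0z R 1) -r0 raddf_sum.
- move=> n r g n0 r0 rn rg.
  have nR0 : n%:~R != 0 :> R by rewrite intr_eq0 gt_eqF.
  pose l i : R := (r i)%:~R / n%:~R.
  have l0 i : 0 <= l i by rewrite divr_ge0 // ler0z // ltW.
  have l1 : \sum_i l i = 1 by rewrite -mulr_suml -raddf_sum /= rn divff.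
  have le1 i : l i <= 1 by rewrite -l1 (bigD1 i) //= lerDl sumr_ge0.
  have lg : \sum_i l i *: v i = map_mx intr g.
    have ng : n%:~R *: map_mx intr g = \sum_i (r i)%:~R *: v i by rewrite sumZ rg map_mxZ.
    apply: (scalerI nR0); rewrite [RHS]ng scaler_sumr.
    by apply: eq_bigr => i _; rewrite scalerA mulrC divfK.
  have gZ : integer_points (\sum_i l i *: v i).
    by rewrite lg => i; rewrite mxE; exact: intr_int.
  have [li|nli] := pselect (tetra_interior v (\sum_i l i *: v i)); [right|left].
  + move=> i; have : [set barycentre v] (\sum_i l i *: v i) by rewrite -itr.
    have s4 : \sum_i l i = \sum_(i < 4) (1 / 4).
      by rewrite l1 sumr_const card_ord -[RHS]mulr_natr divfK ?pnatr_eq0.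
    move=> /(affinely_independent_inj ind s4) /(_ i).
    move=> /eqP; rewrite eqr_div ?pnatr_eq0 // mul1r => /eqP e.
    by apply: (@intr_inj R); rewrite rmorphM /= -e.
  + have : range v (\sum_i l i *: v i).
      rewrite -bd; split => //; split => //.
      by exists l; split=> // i; rewrite l0 le1.
    move=> [j _ e]; exists j.
    have e' : \sum_i l i *: v i = \sum_i (i == j)%:R *: v i.
      rewrite -e [RHS](bigD1 j) //= eqxx scale1r big1 ?addr0 // => i /negPf ->.
      by rewrite scale0r.
    have := affinely_independent_inj ind _ e' j; rewrite l1 eqxx.
    rewrite (bigD1 j) //= eqxx big1 ?addr0; last by move=> i /negPf ->.
    move=> /(_ erefl) /divr1_eq /intr_inj //.
- have [_ /integer_pointsP [g gE]] :
      (tetra_interior v `&` integer_points (R:=R)) (barycentre v).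
    by rewrite itr.
  exists g; apply/matrixP => i j; apply: (@intr_inj R).
  have := congr1 (fun x : 'cV[R]_3 => (4 *: x) i j) gE.
  rewrite /barycentre scaler_sumr;
  under eq_bigr do rewrite scalerA mul1r divff ?pnatr_eq0 // scale1r vE.
  rewrite !mxE rmorphM /= => <-; rewrite !summxE raddf_sum /=.
  by apply: eq_bigr => k _; rewrite mxE.
Qed.

Lemma sum_ord4 (V : nmodType) (F : 'I_4 -> V) :
  \sum_i F i = F 0 + F 1 + F 2 + F 3.
Proof.
rewrite !big_ord_recr big_ord0 /= add0r.
by congr (F _ + F _ + F _ + F _); apply: val_inj.
Qed.

(** Unimodular affine maps preserve integer points and barycentric
coordinates. *)
Lemma lattice_barycentricZ_affine (v w : 'I_4 -> 'cV[int]_3) p (Q : 'M[int]_3) :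
  Q \in unitmx -> (forall i, v i = p + Q *m w i) ->
  lattice_barycentricZ v -> lattice_barycentricZ w.
Proof.
move=> uQ vw [ind lat [g gE]].
have vwS r : \sum_i r i *: v i = (\sum_i r i) *: p + Q *m (\sum_i r i *: w i).
  rewrite mulmx_sumr scaler_suml -big_split; apply: eq_bigr => i _ /=.
  by rewrite vw scalerDr scalemxAr.
split.
- by move=> r r0 rw0; apply: ind => //; rewrite vwS r0 rw0 scale0r mulmx0 addr0.
- move=> n r h n0 r0 rn rh; apply: (lat n r (p + Q *m h)) => //.
  by rewrite vwS rn rh -scalemxAr scalerDr.
- exists (invmx Q *m (g - p)).
  rewrite scalemxAr scalerBr -gE (eq_bigr _ (fun i _ => vw i)) big_split /=.
  by rewrite sumr_const card_ord scaler_nat (addrC (p *+ 4)) addrK -mulmx_sumr mulKmx.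
Qed.

(** Reducing r1 and r2 modulo s yields a lattice point of the parallelogram
spanned by two edges of the tetrahedron.  This point or its reflection in the
centre of the parallelogram lies in the triangle spanned by these edges, which
contains no lattice points other than its vertices. *)
Lemma face_primitive (v : 'I_4 -> 'cV[int]_3) (s r1 r2 : int) g : lattice_barycentricZ v ->
  r1 *: (v 1 - v 0) + r2 *: (v 2 - v 0) = s *: g ->
  (s %| r1)%Z /\ (s %| r2)%Z.
Proof.
move=> [ind lat _].
wlog s0 : s g / 0 <= s => [hw e|].
  have [s0|/ltW s0] := leP 0 s; first exact: (hw s g).
  rewrite !dvdzE -(abszN s) -!dvdzE.
  by apply: (hw _ (- g)); rewrite ?oppr_ge0 // scaleNr scalerN opprK.
move=> e.
have [s0'|sn0] := eqVneq s 0.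
  have := ind (fun i : 'I_4 => [:: - (r1 + r2); r1; r2; 0]`_i).
  rewrite !sum_ord4 /= => /(_ ltac:(ring) _) h.
  have {}h : forall i : 'I_4, [:: - (r1 + r2); r1; r2; 0]`_i = 0.
    apply: h; rewrite scale0r addr0 -[RHS](scale0r g) -s0' -e.
    by apply/matrixP => i j; rewrite !mxE; ring.
  by have := h 1; have := h 2; rewrite /= s0' => -> ->; rewrite dvdz0.
have {s0 sn0} s0 : 0 < s by rewrite lt_neqAle eq_sym sn0.
pose f1 := (r1 %% s)%Z; pose f2 := (r2 %% s)%Z.
have f10 : 0 <= f1 by rewrite modz_ge0 // gt_eqF.
have f20 : 0 <= f2 by rewrite modz_ge0 // gt_eqF.
have f1s : f1 < s by rewrite ltz_pmod.
have f2s : f2 < s by rewrite ltz_pmod.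
pose h := g - (r1 %/ s)%Z *: (v 1 - v 0) - (r2 %/ s)%Z *: (v 2 - v 0).
have hE : f1 *: (v 1 - v 0) + f2 *: (v 2 - v 0) = s *: h.
  rewrite /h !scalerBr -e /f1 /f2 /modz.
  by apply/matrixP => i j; rewrite !mxE; ring.
suff [e1 e2] : f1 = 0 /\ f2 = 0 by split; exact/dvdz_mod0P.
have [le1|gt1] := leP (f1 + f2) s.
- have := lat s (fun i : 'I_4 => [:: s - f1 - f2; f1; f2; 0]`_i) (v 0 + h) s0.
  rewrite !sum_ord4 /= => /(_ _ _ _)[|||[j]|].
  + by case=> [[|[|[|[|//]]]] ?] //=; clear -le1; lia.
  + by ring.
  + rewrite scalerDr -hE; apply/matrixP => i j; rewrite !mxE; ring.
  + by case: j => [[|[|[|[|//]]]] ?] /=; clear -f1s f2s f10 f20 s0; lia.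
  + by move=> /(_ 3) /=; clear -s0; lia.
(* the reflected point *)
- have := lat s (fun i : 'I_4 => [:: f1 + f2 - s; s - f1; s - f2; 0]`_i)
    (v 1 + v 2 - v 0 - h) s0.
  rewrite !sum_ord4 /= => /(_ _ _ _)[|||[j]|].
  + by case=> [[|[|[|[|//]]]] ?] //=; clear -gt1 f1s f2s; lia.
  + by ring.
  + rewrite scalerBr -hE; apply/matrixP => i j; rewrite !mxE; ring.
  + by case: j => [[|[|[|[|//]]]] ?] /=; clear -f1s f2s f10 f20 s0 gt1; lia.
  + by move=> /(_ 3) /=; clear -s0; lia.
Qed.

(** * Reduction to the tetrahedra T(a, b, c) *)

Definition Tabc_lattice (a b c : int) : 'I_4 -> 'cV[int]_3 :=
  tnth [tuple 0; delta_mx 0 0; delta_mx 1 0;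
        a *: delta_mx 0 0 + b *: delta_mx 1 0 + c *: delta_mx 2 0].

Lemma real_points_Tabc a b c : real_points (Tabc_lattice a b c) =1 Tabc_vertices R a b c.
Proof.
move=> i; rewrite /real_points /Tabc_lattice /Tabc_vertices /std_basis !(tnth_nth 0).
case: i => [[|[|[|[|//]]]] ?] /=; rewrite ?map_mx0 ?map_delta_mx //.
by rewrite !raddfD /= !map_mxZ !map_delta_mx.
Qed.

Lemma Tabc_latticeE a b c (r : 'I_4 -> int) :
  \sum_i r i *: Tabc_lattice a b c i =
  \col_j [:: r 1 + a * r 3; r 2 + b * r 3; c * r 3]`_j.
Proof.
apply/matrixP => j k; rewrite sum_ord4 !ord1 !mxE !eqxx !andbT.
case: j => [[|[|[|//]]] ?] /=; ring.
Qed.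

(** In the Smith normal form L S P of the 3 x 2 matrix with columns u1 and u2,
the column j of L, multiplied by the invariant d_j, is the combination of u1 and
u2 with coefficients from the column j of the inverse of P.  By hypothesis d_j
divides this column, so it divides 1.  Hence S P is the left part of an
invertible matrix, which L maps to the required one. *)
Lemma extend_to_basis (u1 u2 : 'cV[int]_3) :
  (forall (s r1 r2 : int) g, r1 *: u1 + r2 *: u2 = s *: g ->
    (s %| r1)%Z /\ (s %| r2)%Z) ->
  exists Q : 'M[int]_3, [/\ Q \in unitmx, col 0 Q = u1 & col 1 Q = u2].
Proof.
move=> prim; pose E : 'M[int]_(3, 2) := \matrix_(i, j) (if j == 0 then u1 i 0 else u2 i 0).
have [L uL [P uP [d _ EE]]] := int_Smith_normal_form E.
set S := \matrix_(i, j) _ in EE.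
have d_unit (j : 'I_2) : d`_j \is a GRing.unit.
  pose r (k : 'I_2) := invmx P k j.
  have e : r 0 *: u1 + r 1 *: u2 = d`_j *: col (widen_ord (isT : 2 <= 3)%N j) L.
    have : E *m invmx P = L *m S by rewrite EE mulmxK.
    move=> /matrixP ee; apply/matrixP => i k.
    have := ee i j; rewrite !mxE !big_ord_recl !big_ord0.
    have -> : lift ord0 ord0 = 1 :> 'I_2 by apply: val_inj.
    rewrite !mxE /= ord1 -/(r 0) -/(r 1) !addr0 => e; rewrite mulrC [r 1 * _]mulrC e.
    case: j {r ee e} => [[|[|//]] jj] /=.
      rewrite mulr1n !mulr0n !mulr0 !addr0 mulrC; congr (_ * L _ _); exact: val_inj.
    rewrite mulr1n !mulr0n !mulr0 !addr0 add0r mulrC; congr (_ * L _ _); exact: val_inj.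
  have [d0 d1] := prim _ _ _ _ e.
  have := congr1 (fun M : 'M_2 => M j j) (mulmxV uP); rewrite !mxE eqxx.
  rewrite !big_ord_recl !big_ord0 addr0.
  have -> : lift ord0 ord0 = 1 :> 'I_2 by apply: val_inj.
  move=> p1; have : (d`_j %| true%:R)%Z by rewrite -p1 rpredD // dvdz_mull.
  rewrite dvdz1; case: (d`_j) => [[|[|?]]|[|?]] //.
pose B : 'M[int]_(2 + 1) := block_mx (diag_mx (\row_j d`_j) *m P) 0 0 1%:M.
exists (L *m B).
have uB : B \in unitmx.
  rewrite unitmxE det_ublock det1 mulr1 det_mulmx unitrM -!unitmxE uP andbT.
  rewrite unitmxE det_diag rpred_prod // => j _; rewrite mxE; exact: d_unit.
have colB j : col (lshift 1 j) (L *m B) = col j E.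
  rewrite EE -mulmxA !colE -!mulmxA; congr (_ *m _); rewrite -!colE.
  apply/matrixP => i k; rewrite [LHS]mxE [RHS]mxE /B.
  case: (@split_ordP 2 1 i) => i' ->; last first.
    transitivity ((0 : 'M[int]_(1, 2)) i' j); first exact: block_mxEdl.
    rewrite mxE big1 // => l _; rewrite mxE.
    by rewrite (_ : (_ == _) = false) ?mul0r // !ord1; case: l => [[|[|//]]].
  transitivity ((diag_mx (\row_l d`_l) *m P) i' j); first exact: block_mxEul.
  rewrite mxE; apply: eq_bigr => l _; rewrite !mxE /=.
  by rewrite -val_eqE; case: eqP => // ->.
split; first by rewrite unitmx_mul uL.
- transitivity (col 0 E); first by rewrite -colB; congr (col _ _); exact: val_inj.
  by apply/matrixP => i k; rewrite !mxE ord1.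
- transitivity (col 1 E); first by rewrite -colB; congr (col _ _); exact: val_inj.
  by apply/matrixP => i k; rewrite !mxE ord1.
Qed.

(** The two edges at v 0 of the face v 0, v 1, v 2 extend to a basis of the
lattice.  The coordinates of the third edge in this basis are a, b, c; changing
the sign of the last basis vector makes c positive. *)
Lemma normal_form (v : 'I_4 -> 'cV[int]_3) : lattice_barycentricZ v ->
  exists p Q a b c,
    [/\ Q \in unitmx, 0 < c & forall i, v i = p + Q *m Tabc_lattice a b c i].
Proof.
move=> bv; have [Q [uQ Q0 Q1]] :=
  extend_to_basis (fun s r1 r2 g => @face_primitive v s r1 r2 g bv).
have [z zE] : exists z : 'cV[int]_3, v 3 = v 0 + Q *m z.
  by exists (invmx Q *m (v 3 - v 0)); rewrite mulKVmx // addrC subrK.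
have vE i : v i = v 0 + Q *m Tabc_lattice (z 0 0) (z 1 0) (z 2 0) i.
  rewrite /Tabc_lattice (tnth_nth 0); case: i => [[|[|[|[|//]]]] ii] /=.
  - by rewrite mulmx0 addr0; congr v; apply: val_inj.
  - by rewrite -colE Q0 addrC subrK; congr v; apply: val_inj.
  - by rewrite -colE Q1 addrC subrK; congr v; apply: val_inj.
  - rewrite (_ : _ + _ + _ = z); first by rewrite -zE; congr v; apply: val_inj.
    apply/matrixP => i k; rewrite !mxE !ord1 !eqxx !andbT.
    case: i => [[|[|[|//]]] jj] /=;
      by rewrite ?mulr0 ?mulr1 ?addr0 ?add0r; congr (z _ _); exact: val_inj.
have bz := lattice_barycentricZ_affine uQ vE bv.
have [c0|c0|c0] := ltgtP (z 2 0) 0; last 1 first.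
- have [ind _ _] := bz.
  (* for c = 0 the vertices would lie in a plane *)
  pose r (i : 'I_4) : int := [:: z 0 0 + z 1 0 - 1; - z 0 0; - z 1 0; 1]`_i.
  have := ind r; rewrite sum_ord4 Tabc_latticeE /r /= => /(_ _ _ 3) /=.
  move=> h; suff: 1 = 0 :> int by [].
  apply: h; first by ring.
  apply/matrixP => i k; rewrite !mxE c0; case: i => [[|[|[|//]]] jj] /=; ring.
- pose D : 'M[int]_3 := diag_mx (\row_j [:: 1; 1; -1]`_j).
  exists (v 0), (Q *m D), (z 0 0), (z 1 0), (- z 2 0); split.
  + rewrite unitmx_mul uQ unitmxE det_diag rpred_prod // => j _; rewrite mxE.
    by case: j => [[|[|[|//]]] jj].
  + by rewrite oppr_gt0.
  + move=> i; rewrite {1}vE -mulmxA; congr (_ + _ *m _).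
    apply/matrixP => j k; rewrite mul_diag_mx !mxE /Tabc_lattice !(tnth_nth 0).
    case: i => [[|[|[|[|//]]]] ii]; case: j => [[|[|[|//]]] jj]; rewrite /= !mxE /=; ring.
- by exists (v 0), Q, (z 0 0), (z 1 0), (z 2 0).
Qed.

(** * The lattice barycentric tetrahedra T(a, b, c) *)

Lemma divz_nat (a : int) (n : nat) : (0 < n)%N ->
  exists (q : int) (y : nat), [/\ (y < n)%N, a = q * n + y & (a %% n)%Z = y].
Proof.
move=> n0; exists (a %/ n)%Z, `|(a %% n)%Z|%N.
have r0 : 0 <= (a %% n)%Z by rewrite modz_ge0 //; lia.
have rn : (a %% n)%Z < n by rewrite ltz_pmod //; lia.
rewrite gez0_abs // -divz_eq; split => //.
by clear -r0 rn; lia.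
Qed.

(** When the residues for t add up to t, those of tx, ty, tz together with
n - t are n times the barycentric coordinates of the lattice point g.  It is
not a vertex because these numbers are all less than n = 4m. *)
Lemma Tabc_lone_residue_sum (a b : int) (m x y z : nat) (p q r : int) : (0 < m)%N ->
  1 - a - b = p * (4 * m)%N + x -> a = q * (4 * m)%N + y -> b = r * (4 * m)%N + z ->
  lattice_barycentricZ (Tabc_lattice a b (4 * m)%N) -> lone_residue_sum m x y z.
Proof.
move=> m0 xE yE zE [_ lat _] t tb ts; set n := (4 * m)%N in xE yE zE lat tb ts *.
have n0 : (0 < n)%N by rewrite /n; clear -m0; lia.
pose s (i : 'I_4) : int :=
  [:: (residue n t x : int); (residue n t y : int); (residue n t z : int);
      n%:Z - t%:Z]`_i.
pose g : 'cV[int]_3 := \col_j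
  [:: a - t%:Z * q - (quotient n t y)%:Z; b - t%:Z * r - (quotient n t z)%:Z;
      n%:Z - t%:Z]`_j.
have rx := ltn_residue t x n0; have ry := ltn_residue t y n0.
have rz := ltn_residue t z n0.
have [|||| [j sj]|s4] := lat n s g.
- by clear -n0; lia.
- by case=> [[|[|[|[|//]]]] ii]; rewrite /s /= //; clear -tb; lia.
- by rewrite sum_ord4 /s /=; clear -ts; lia.
- rewrite Tabc_latticeE /s /g; apply/matrixP => i k; rewrite !mxE.
  have qy : t%:Z * y = (quotient n t y)%:Z * n%:Z + residue n t y.
    by rewrite -!PoszM -PoszD -quotient_residue.
  have qz : t%:Z * z = (quotient n t z)%:Z * n%:Z + residue n t z.
    by rewrite -!PoszM -PoszD -quotient_residue.
  have ry' : (residue n t y)%:Z = t%:Z * y - (quotient n t y)%:Z * n%:Z by rewrite qy; ring.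
  have rz' : (residue n t z)%:Z = t%:Z * z - (quotient n t z)%:Z * n%:Z by rewrite qz; ring.
  case: i => [[|[|[|//]]] jj] /=.
  + rewrite ry'; have -> : y%:Z = a - q * n by rewrite yE; ring.
    by ring.
  + rewrite rz'; have -> : z%:Z = b - r * n by rewrite zE; ring.
    by ring.
  + by ring.
- by case: j sj => [[|[|[|[|//]]]] ii]; rewrite /s /=; clear -rx ry rz tb; lia.
- have := s4 0; have := s4 1; have := s4 2; have := s4 3; rewrite /s /= /n.
  by clear; split; lia.
Qed.

(** Integrality of the barycentre gives the congruences modulo 4, and then
[lone_residue_sum_classification] applies. *)
Lemma Tabc_classification (a b c : int) : 0 < c ->
  lattice_barycentricZ (Tabc_lattice a b c) ->
  [/\ c = 4, (a %% 4)%Z = 3 & (b %% 4)%Z = 3] \/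
  c = 20 /\ ((a %% 20)%Z, (b %% 20)%Z) \in
    [:: (7, 11); (11, 7); (3, 11); (11, 3); (3, 7); (7, 3) : int * int].
Proof.
move=> c0 bc; have [_ _ [g]] := bc.
have -> : \sum_i Tabc_lattice a b c i = \sum_i 1 *: Tabc_lattice a b c i.
  by apply: eq_bigr => i _; rewrite scale1r.
rewrite Tabc_latticeE => /matrixP gE.
have a4 : (a %% 4)%Z = 3 by have := gE 0 0; rewrite !mxE /=; clear; lia.
have b4 : (b %% 4)%Z = 3 by have := gE 1 0; rewrite !mxE /=; clear; lia.
have [m m0 cE] : exists2 m : nat, (0 < m)%N & c = (4 * m)%N.
  exists `|g 2%R 0%R|%N; have := gE 2 0; rewrite !mxE /=; clear -c0; lia.
have n0 : (0 < 4 * m)%N by clear -m0; lia.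
have [p [x [xn xE xM]]] := divz_nat (1 - a - b) n0.
have [q [y [yn yE yM]]] := divz_nat a n0.
have [r [z [zn zE zM]]] := divz_nat b n0.
rewrite cE in bc *.
have L := Tabc_lone_residue_sum m0 xE yE zE bc.
have x4 : (x %% 4 = 3)%N by move: xE; clear -a4 b4; lia.
have y4 : (y %% 4 = 3)%N by move: yE; clear -a4 b4; lia.
have z4 : (z %% 4 = 3)%N by move: zE; clear -a4 b4; lia.
have s1 : ((x + y + z) %% (4 * m) = 1)%N.
  have e : ((x + y + z)%N : int) = (- p - q - r) * (4 * m)%N + 1.
    by rewrite !PoszD; move: xE yE zE; clear; lia.
  have : ((x + y + z)%N %% (4 * m)%N)%Z = 1.
    by rewrite e modzMDl modz_small //; clear -m0; lia.
  by rewrite modz_nat => -[].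
have [m1|[m5 e]] := lone_residue_sum_classification m0 L xn yn zn x4 y4 z4 s1.
  by left; rewrite m1.
right; rewrite m5; split => //; move: yM zM; rewrite m5 => -> ->.
have := perm_uniq e; have := perm_mem e y; have := perm_mem e z.
rewrite !inE !eqxx !orbT /= !inE andbT negb_or => /esym /or3P ez /esym /or3P ey.
move=> /andP[_ yz].
by case: ez ey yz => /eqP -> [] /eqP ->.
Qed.

(** * Equivalences between the tetrahedra T(a, b, c) *)

Lemma sum_ord3 (V : nmodType) (F : 'I_3 -> V) : \sum_i F i = F 0 + F 1 + F 2.
Proof.
rewrite !big_ord_recr big_ord0 /= add0r.
by congr (F _ + F _ + F _); apply: val_inj.
Qed.

Definition mx3 (rows : seq (seq int)) : 'M[int]_3 := \matrix_(i, j) (nth [::] rows i)`_j.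

(** The matrix B only serves to show that A is invertible. *)
Lemma Tabc_move (A B : 'M[int]_3) e a b c a' b' (s : 'I_4 -> 'I_4) :
  A *m B = 1%:M -> injective s ->
  (forall i, A *m Tabc_lattice a b c i + e = Tabc_lattice a' b' c (s i)) ->
  unimodularly_equivalent (@Tabc R a b c) (@Tabc R a' b' c).
Proof.
move=> /mulmx1_unit[uA _] s_inj sE; rewrite /Tabc.
rewrite -!(tetrahedron_ext (real_points_Tabc _ _ _)).
exact: (unimodular_tetrahedra uA s_inj sE).
Qed.

Lemma Tabc_shear (a b a' b' c : int) :
  (a = a' %[mod c])%Z -> (b = b' %[mod c])%Z ->
  unimodularly_equivalent (@Tabc R a b c) (@Tabc R a' b' c).
Proof.
move=> /esym/eqP; rewrite eqz_mod_dvd => /dvdzP[i ai].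
move=> /esym/eqP; rewrite eqz_mod_dvd => /dvdzP[j bj].
have {ai}-> : a' = a + i * c by rewrite -ai; ring.
have {bj}-> : b' = b + j * c by rewrite -bj; ring.
apply: (@Tabc_move (mx3 [:: [:: 1; 0; i]; [:: 0; 1; j]; [:: 0; 0; 1]])
  (mx3 [:: [:: 1; 0; - i]; [:: 0; 1; - j]; [:: 0; 0; 1]]) 0 _ _ _ _ _ id) => // [|k].
- apply/matrixP => k l; rewrite !mxE sum_ord3 !mxE.
  by case: k => [[|[|[|//]]] ?]; case: l => [[|[|[|//]]] ?] /=; ring.
- rewrite /Tabc_lattice (tnth_nth 0) [in RHS](tnth_nth 0).
  apply/matrixP => l l'; rewrite !mxE sum_ord3 !ord1 !mxE.
  by case: k => [[|[|[|[|//]]]] ?]; case: l => [[|[|[|//]]] ?]; rewrite /= !mxE /=; ring.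
Qed.

Lemma Tabc_swap12 (a b c : int) :
  unimodularly_equivalent (@Tabc R a b c) (@Tabc R b a c).
Proof.
apply: (@Tabc_move (mx3 [:: [:: 0; 1; 0]; [:: 1; 0; 0]; [:: 0; 0; 1]])
  (mx3 [:: [:: 0; 1; 0]; [:: 1; 0; 0]; [:: 0; 0; 1]]) 0 _ _ _ _ _ (tperm 1 2)) => [||k].
- apply/matrixP => k l; rewrite !mxE sum_ord3 !mxE.
  by case: k => [[|[|[|//]]] ?]; case: l => [[|[|[|//]]] ?] /=; ring.
- exact: perm_inj.
- rewrite /Tabc_lattice permE (tnth_nth 0) [in RHS](tnth_nth 0).
  apply/matrixP => l l'; rewrite !mxE sum_ord3 !ord1 !mxE.
  by case: k => [[|[|[|[|//]]]] ?]; case: l => [[|[|[|//]]] ?]; rewrite /= !mxE /=; ring.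
Qed.

(** The map exchanges the vertices 0 and e_1 and fixes e_2; it permutes the
residues of 1 - a - b, a, b by exchanging the first two. *)
Lemma Tabc_swap01 (a b c : int) :
  unimodularly_equivalent (@Tabc R a b c) (@Tabc R (1 - a - b) b c).
Proof.
apply: (@Tabc_move (mx3 [:: [:: -1; -1; 0]; [:: 0; 1; 0]; [:: 0; 0; 1]])
  (mx3 [:: [:: -1; -1; 0]; [:: 0; 1; 0]; [:: 0; 0; 1]]) (delta_mx 0 0)
   _ _ _ _ _ (tperm 0 1)) => [||k].
- apply/matrixP => k l; rewrite !mxE sum_ord3 !mxE.
  by case: k => [[|[|[|//]]] ?]; case: l => [[|[|[|//]]] ?] /=; ring.
- exact: perm_inj.
- rewrite /Tabc_lattice permE (tnth_nth 0) [in RHS](tnth_nth 0).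
  apply/matrixP => l l'; rewrite !mxE sum_ord3 !ord1 !mxE.
  by case: k => [[|[|[|[|//]]]] ?]; case: l => [[|[|[|//]]] ?]; rewrite /= !mxE /=; ring.
Qed.

(** In all six cases 1 - a - b, a, b are congruent to 3, 7, 11 in some order,
and the two exchanges of vertices generate the permutations of these. *)
Lemma Tabc_20 (a b : int) :
  ((a %% 20)%Z, (b %% 20)%Z) \in
    [:: (7, 11); (11, 7); (3, 11); (11, 3); (3, 7); (7, 3) : int * int] ->
  unimodularly_equivalent (@Tabc R a b 20) (@Tabc R 7 11 20).
Proof.
have direct x y : (x %% 20)%Z = 7 -> (y %% 20)%Z = 11 ->
  unimodularly_equivalent (@Tabc R x y 20) (@Tabc R 7 11 20)
  by move=> x7 y11; apply: Tabc_shear; rewrite ?x7 ?y11.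
have swapped x y : (x %% 20)%Z = 11 -> (y %% 20)%Z = 7 ->
  unimodularly_equivalent (@Tabc R x y 20) (@Tabc R 7 11 20).
  move=> x11 y7; apply: (unimodularly_equivalent_trans (Tabc_swap12 x y 20)).
  exact: direct.
have three x y : (x %% 20)%Z = 3 -> (y %% 20)%Z \in [:: 7; 11 : int] ->
  unimodularly_equivalent (@Tabc R x y 20) (@Tabc R 7 11 20).
  move=> x3; rewrite !inE => y711.
  apply: (unimodularly_equivalent_trans (Tabc_swap01 x y 20)).
  by case/orP: y711 => /eqP y711; [apply: swapped | apply: direct] => //;
    clear -x3 y711; lia.
rewrite !inE !xpair_eqE => /or4P [||| /or3P []] /andP[/eqP ea /eqP eb].
- exact: direct.
- exact: swapped.
- by apply: three; rewrite ?eb.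
- apply: (unimodularly_equivalent_trans (Tabc_swap12 a b 20)).
  by apply: three; rewrite ?ea.
- by apply: three; rewrite ?eb.
- apply: (unimodularly_equivalent_trans (Tabc_swap12 a b 20)).
  by apply: three; rewrite ?ea.
Qed.

End Geometry.

Theorem proposition1p3 (R : realType) (v : 'I_4 -> 'cV[R]_3)
    (hv : lattice_barycentric v) :
  unimodularly_equivalent (tetrahedron v) (Tabc 3 3 4) \/
  unimodularly_equivalent (tetrahedron v) (Tabc 7 11 20).
Proof.
have [vz vE bvz] := lattice_barycentricP hv.
have [p [Q [a [b [c [uQ c0 vzE]]]]]] := normal_form bvz.
have bT := lattice_barycentricZ_affine uQ vzE bvz.
have vT : unimodularly_equivalent (tetrahedron v) (@Tabc R a b c).
  rewrite (tetrahedron_ext vE) /Tabc -(tetrahedron_ext (real_points_Tabc R _ _ _)).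
  apply: (@unimodular_tetrahedra R _ _ (invmx Q) (- (invmx Q *m p))%R id) => // [|i].
    by rewrite unitmx_inv.
  by rewrite vzE mulmxDr mulKmx // addrC addKr.
have [[c4 a4 b4]|[c20 ab]] := Tabc_classification c0 bT; [left|right];
  apply: (unimodularly_equivalent_trans vT).
- by rewrite c4; apply: Tabc_shear.
- by rewrite c20; apply: Tabc_20.
Qed.
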